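(* Let $q$ be a prime power, $\alpha$ a primitive element of $\mathbf{F}_q$, $k$ an integer with $1\le k\le q-2$, and $d=q-k$. Let $g(x)=(x-\alpha)(x-\alpha^2)\cdots(x-\alpha^{d-1})$ and let $\mathcal{C}=\{g(x)m(x): m\in\mathbf{F}_q[x],\ \deg m\le k-1\}$ (the cyclic code version of the standard Reed–Solomon code of length $n=q-1$). Let $g_1(x)=g(x)/(x-\alpha)$. Then for every $a\in\mathbf{F}_q^*$ and every $l\in\mathbf{F}_q[x]$ with $\deg l\le k-1$, the polynomial $a g_1(x)+l(x)g(x)$ is a deep hole of $\mathcal{C}$, i.e. $d(ag_1+lg,\mathcal{C})=q-1-k$.
   Context: Polynomials of degree at most $q-2$ are identified with their coefficient vectors in $\mathbf{F}_q^{q-1}$. The distance $d(s,t)$ between two such polynomials is the number of indices $i\in\{0,\dots,q-2\}$ at which the coefficients of $x^i$ in $s$ and $t$ differ, and $d(u,\mathcal{C})=\min\{d(u,c):c\in\mathcal{C}\}$. A polynomial $u$ of degree at most $q-2$ is a deep hole of $\mathcal{C}$ if $d(u,\mathcal{C})=n-k=q-1-k$. *)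

(* Defs.v *)
From HB Require Import structures.
From mathcomp Require Import all_boot all_order all_fingroup all_algebra.
From mathcomp Require Import all_solvable.

Set Implicit Arguments.
Unset Strict Implicit.
Unset Printing Implicit Defensive.

Import GRing.Theory.
Local Open Scope ring_scope.

Section HammingDistance.
Variables (F : finFieldType) (n : nat).
Implicit Types (s t u : {poly F}) (C : {set {poly_n F}}).

Definition hdist s t : nat := #|[set i : 'I_n | s`_i != t`_i]|.

(* The default value n bounds every distance, so for nonempty C this is the
   minimum of hdist u c over c in C: see hdist_codeP. *)
Definition hdist_code u C : nat := \big[minn/n]_(c in C) hdist u c.

Definition deep_hole (k : nat) C u : Prop :=
  (size u <= n)%N /\ hdist_code u C = (n - k)%N.

Lemma hdist_codeP u C : C != set0 ->
  (exists2 c, c \in C & hdist_code u C = hdist u c) /\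
  (forall c, c \in C -> (hdist_code u C <= hdist u c)%N).
Proof.
have dist_le c : (hdist u c <= n)%N.
  by rewrite -[leqRHS]card_ord max_card.
have min_le c : c \in C -> (hdist_code u C <= hdist u c)%N.
  rewrite /hdist_code => cC; have := mem_index_enum c.
  elim: (index_enum _) => //= c' r IHr; rewrite inE big_cons.
  case/predU1P=> [<-|/IHr le_r]; first by rewrite cC geq_minl.
  by case: ifP => // _; rewrite geq_min le_r orbT.
case/set0Pn=> c0 c0C; split=> //.
pose c1 := [arg min_(c < c0 in C) hdist u c].
have [c1C c1min] : c1 \in C /\ (forall c, c \in C -> (hdist u c1 <= hdist u c)%N).
  by rewrite /c1; case: arg_minnP.
exists c1 => //; apply/eqP; rewrite eqn_leq min_le //=.
apply: (big_ind (fun x => (hdist u c1 <= x)%N)) => // x y hx hy.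
by rewrite leq_min hx hy.
Qed.

End HammingDistance.

Section CyclicReedSolomon.
Variable F : finFieldType.
Implicit Types (alpha : F) (k : nat).

Definition primitive_element alpha : Prop :=
  exists2 u : {unit F}, val u = alpha & generator [set: {unit F}] u.

Definition rs_gen alpha k : {poly F} :=
  \prod_(1 <= i < #|F| - k) ('X - (alpha ^+ i)%:P).

Definition rs_gen1 alpha k : {poly F} := rs_gen alpha k %/ ('X - alpha%:P).

(* The type {poly_n F} bounds the size: deg m <= k - 1 is m : {poly_k F}, and
   codewords have degree at most #|F| - 2.  The latter bound excludes no
   multiple g * m: see rs_codeP. *)
Definition rs_code alpha k : {set {poly_(#|F| - 1) F}} :=
  [set c : {poly_(#|F| - 1) F} |
     [exists m : {poly_k F}, (c : {poly F}) == rs_gen alpha k * (m : {poly F})]].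

Lemma rs_codeP alpha k (p : {poly F}) : (k <= #|F| - 2)%N ->
  (exists2 c, c \in rs_code alpha k & p = c) <->
  (exists2 m : {poly F}, (size m <= k)%N & p = rs_gen alpha k * m).
Proof.
move=> hk; split=> [[c]|[m sm ->]].
  by rewrite inE => /existsP[m /eqP em] ->; exists m; rewrite ?size_npoly.
have smn : (size (rs_gen alpha k * m)%R <= #|F| - 1)%N.
  apply: leq_trans (size_polyMleq _ _) _.
  rewrite size_prod_XsubC size_iota addSn /= subnAC.
  apply: leq_trans (leq_add (leqnn _) sm) _.
  by rewrite subnK // (leq_trans hk) // leq_sub2l.
exists (NPoly smn) => //; rewrite inE; apply/existsP.
by exists (NPoly (sm : m \is a poly_of_size k)).
Qed.

End CyclicReedSolomon.

(* Main.v *)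
Require Import Defs.
From HB Require Import structures.
From mathcomp Require Import all_boot all_order all_fingroup all_algebra.
From mathcomp Require Import all_solvable zify ring.

Set Implicit Arguments.
Unset Strict Implicit.
Unset Printing Implicit Defensive.

Import GRing.Theory.
Local Open Scope ring_scope.

(** Write n = q - 1.  A codeword differs from the given word by
    [a *: g1 + m * g], which is nonzero because its cofactor of [g1] takes
    the value a at alpha, and vanishes at the n - k - 1 consecutive powers
    alpha^2, ..., alpha^(n - k); by the BCH bound it has at least n - k nonzero
    coefficients.  The codeword [l * g] is at distance at most n - k, since [g1]
    has degree n - k - 1. *)

(* If the support S of [p] had at most [t] elements, then for i0 in S the
   polynomial h = prod_(i in S, i != i0) ('X - x ^ i) would have degree < t, and
   sum_j h_j p(x ^ (b + j)) = sum_i p_i x ^ (b i) h(x ^ i) would reduce to its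
   nonzero term i = i0, although every p(x ^ (b + j)) vanishes. *)
Lemma bch_bound (F : fieldType) (x : F) (n b t : nat) (p : {poly F}) :
    x != 0 -> injective (fun i : 'I_n => x ^+ i) ->
    (size p <= n)%N -> p != 0 ->
    (forall j, (j < t)%N -> root p (x ^+ (b + j))) ->
  (t < #|[set i : 'I_n | (p`_i != 0)%R]|)%N.
Proof.
move=> x0 x_inj sp p0 p_root; set S := [set i | _].
(* As [p] is nonzero, its degree is an index in the support; any other support index would serve. *)
have i0n : ((size p).-1 < n)%N by rewrite prednK // size_poly_gt0.
pose i0 := Ordinal i0n.
have i0S : i0 \in S by rewrite inE /= -lead_coefE lead_coef_eq0.
rewrite ltnNge; apply/negP => leSt.
pose h := \prod_(i in S :\ i0) ('X - (x ^+ i)%:P).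
(* There is one factor per element of [S] other than [i0], so the degree is [#|S| - 1] and the size
   is [#|S|]. *)
have sh : (size h <= t)%N.
  by rewrite /h -big_enum size_prod_XsubC -cardE; move: leSt; rewrite (cardsD1 i0) i0S.
have hE (i : 'I_n) : h.[x ^+ i] = \prod_(j in S :\ i0) (x ^+ i - x ^+ j).
  by rewrite horner_prod; apply: eq_bigr => j _; rewrite !hornerE.
have : \sum_(j < t) h`_j * p.[x ^+ (b + j)] = 0.
  by apply: big1 => j _; rewrite (rootP (p_root _ (ltn_ord j))) mulr0.
have -> : \sum_(j < t) h`_j * p.[x ^+ (b + j)] =
          \sum_(i < n) p`_i * x ^+ (b * i) * h.[x ^+ i].
  under eq_bigr do rewrite (horner_coef_wide _ sp) big_distrr /=.
  rewrite exchange_big /=; apply: eq_bigr => i _.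
  rewrite (horner_coef_wide _ sh) big_distrr /=; apply: eq_bigr => j _.
  rewrite -!exprM mulnDl exprD [(i * j)%N]mulnC; ring.
rewrite (bigD1 i0) //= big1 ?addr0 => [|i ii0].
  apply/eqP; rewrite !mulf_neq0 ?expf_neq0 //; first by move: i0S; rewrite inE.
  rewrite (hE i0); apply/prodf_neq0 => j; rewrite !inE => /andP[ji0 _].
  by rewrite subr_eq0; apply: contraNneq ji0 => /x_inj ->.
(* For [i] in [S] the factor of [h] at [i] vanishes; outside [S] the coefficient of [p] does. *)
have [iS|] := boolP (i \in S); last by rewrite inE negbK => /eqP ->; rewrite !mul0r.
by rewrite hE (bigD1 i) ?in_setD1 ?ii0 //= subrr mul0r mulr0.
Qed.

Lemma primitive_element_neq0 (F : finFieldType) (alpha : F) :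
  primitive_element alpha -> alpha != 0.
Proof. by case=> u <- _; rewrite -unitfE (valP u). Qed.

(** A generator of the unit group has order [#|F| - 1], so powers with exponents below this bound
    are distinct. *)
Lemma primitive_element_expr_inj (F : finFieldType) (alpha : F) :
  primitive_element alpha -> injective (fun i : 'I_(#|F| - 1) => alpha ^+ i).
Proof.
case=> u <- /eqP ug i j; rewrite -!FinRing.val_unitX => /val_inj /eqP.
have ou : #[u]%g = (#|F| - 1)%N by rewrite orderE -ug card_finField_unit subn1.
by rewrite eq_expg_mod_order ou !modn_small // => /eqP /val_inj.
Qed.

Lemma hdistE (F : finFieldType) n (s t : {poly F}) :
  hdist n s t = #|[set i : 'I_n | (s - t)`_i != 0]|.
Proof. by congr #|pred_of_set _|; apply/setP => i; rewrite !inE coefB subr_eq0. Qed.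

Lemma hdist_le_size (F : finFieldType) n (s t : {poly F}) :
  (hdist n s t <= size (s - t)%R)%N.
Proof.
rewrite hdistE cardE -(size_map val) -[leqRHS](size_iota 0).
apply: uniq_leq_size; first by rewrite map_inj_uniq ?enum_uniq //; apply: val_inj.
move=> _ /mapP[i + ->]; rewrite mem_enum inE mem_iota add0n /= ltnNge.
by apply: contraNN => /leq_sizeP ->.
Qed.

(** The bound on [k] makes the range of [rs_gen] nonempty, so the factor at exponent 1 splits off
    and cancels. *)
Lemma rs_gen1E (F : finFieldType) (alpha : F) k : (k <= #|F| - 2)%N ->
  rs_gen1 alpha k = \prod_(2 <= i < #|F| - k) ('X - (alpha ^+ i)%:P).
Proof.
move=> hk; rewrite /rs_gen1 /rs_gen big_ltn ?expr1 ?mulKp ?polyXsubC_eq0 //.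
by have : (1 < #|F|)%N := card_finNzRing_gt1 F; lia.
Qed.

Lemma rs_genE (F : finFieldType) (alpha : F) k : (k <= #|F| - 2)%N ->
  rs_gen alpha k = ('X - alpha%:P) * rs_gen1 alpha k.
Proof.
move=> hk; rewrite rs_gen1E // /rs_gen big_ltn ?expr1 //.
by have : (1 < #|F|)%N := card_finNzRing_gt1 F; lia.
Qed.

Lemma size_rs_gen1 (F : finFieldType) (alpha : F) k : (k <= #|F| - 2)%N ->
  size (rs_gen1 alpha k) = (#|F| - 1 - k)%N.
Proof.
move=> hk; rewrite rs_gen1E // size_prod_XsubC size_iota.
by have : (1 < #|F|)%N := card_finNzRing_gt1 F; lia.
Qed.

Theorem theorem2p3 (F : finFieldType) (alpha : F)
    (halpha : primitive_element alpha)
    (k : nat) (hk : (1 <= k <= #|F| - 2)%N)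
    (a : F) (ha : a != 0) (l : {poly F}) (hl : (size l <= k)%N) :
  deep_hole k (rs_code alpha k) (a *: rs_gen1 alpha k + l * rs_gen alpha k).
Proof.
case/andP: hk => k_gt0 hk; set g := rs_gen _ _; set g1 := rs_gen1 _ _.
have q_gt1 : (1 < #|F|)%N := card_finNzRing_gt1 F.
have sg1 : size g1 = (#|F| - 1 - k)%N by apply: size_rs_gen1.
have g1_neq0 : g1 != 0 by rewrite -size_poly_eq0 sg1; lia.
have [c0 c0C c0E] : exists2 c, c \in rs_code alpha k & l * g = c.
  by apply/rs_codeP => //; exists l; rewrite // mulrC.
have sag1 : (size (a *: g1) <= #|F| - 1 - k)%N.
  by rewrite -sg1; apply: size_scale_leq.
have su : (size (a *: g1 + l * g)%R <= #|F| - 1)%N.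
  apply: leq_trans (size_polyD _ _) _; rewrite geq_max c0E size_npoly andbT.
  exact: leq_trans sag1 (leq_subr _ _).
split=> //.
(* Nonemptiness makes the distance attained, so the lower bound is needed only at a nearest codeword
   [c]. *)
have C_neq0 : rs_code alpha k != set0 by apply/set0Pn; exists c0.
have [[c cC dE] min_le] := hdist_codeP (a *: g1 + l * g) C_neq0.
apply/eqP; rewrite eqn_leq; apply/andP; split.
  apply: leq_trans (min_le _ c0C) _; apply: leq_trans (hdist_le_size _ _ _) _.
  by rewrite -c0E addrK.
have [m sm cE] : exists2 m : {poly F}, (size m <= k)%N & c = g * m :> {poly F}.
  by apply/(rs_codeP _ _ hk); exists c.
pose r := a%:P + (l - m) * ('X - alpha%:P).
have uE : a *: g1 + l * g - c = g1 * r.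
  transitivity (a *: g1 + l * g - g * m); first by congr (_ - _).
  rewrite /r [g]rs_genE // -/g1 -mul_polyC; ring.
have r_neq0 : r != 0.
  apply: contraNneq ha => /(congr1 (horner^~ alpha)).
  by rewrite /r !hornerE subrr mulr0 addr0 => ->.
(* The strict inequality of [bch_bound] adds one to the [#|F| - k - 2] consecutive roots of [g1],
   which start at exponent 2. *)
have -> : (#|F| - 1 - k = (#|F| - k - 2).+1)%N by lia.
rewrite dE hdistE; apply: (bch_bound (x := alpha) (b := 2)).
- exact: primitive_element_neq0.
- exact: primitive_element_expr_inj.
- apply: leq_trans (size_polyD _ _) _.
  by rewrite geq_max su size_polyN size_npoly.
- by rewrite uE mulf_neq0.
move=> j j_lt; rewrite uE rootM; apply/orP; left.
rewrite [g1]rs_gen1E // -(big_map (GRing.exp alpha) predT (fun z => 'X - z%:P)).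
rewrite root_prod_XsubC.
by apply/map_f; rewrite mem_index_iota; lia.
Qed.
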